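(* Let $\mathscr{A}\in\mathbb{C}^{n\times n\times p}$ and let $d=(d_1,\dots,d_p)^T\in\mathbb{C}^p$ be an eigentuple of $\mathscr{A}$ with associated eigenmatrix $X\in\mathbb{C}^{n\times p}$. Let the tubular tensor $[\lambda]$ of length $p$ and the tensor $\mathscr{X}\in\mathbb{C}^{n\times 1\times p}$ be defined by $$[\lambda]_{111}=d_1,\qquad [\lambda]_{11i}=d_{p-i+2}\ \text{ for } i=2,3,\ldots,p,\qquad \mathrm{Unfold}(\mathscr{X})=\mathrm{vec}(X).$$ If $\mathscr{X}^H*\mathscr{X}$ is non-singular, then $[\lambda]$ is a tubular eigenvalue of $\mathscr{A}$ with corresponding eigentensor $\mathscr{X}$.
   Context: For a tensor $\mathscr{X}\in\mathbb{C}^{n\times m\times p}$, $X_k\in\mathbb{C}^{n\times m}$ ($k=1,\dots,p$) denotes the $k$-th frontal slice (third index fixed to $k$). $\mathrm{Unfold}(\mathscr{X})\in\mathbb{C}^{np\times m}$ stacks $X_1,\dots,X_p$ vertically in this order, and $\mathrm{Fold}$ is its inverse. $\mathrm{bcirc}(\mathscr{X})\in\mathbb{C}^{np\times mp}$ is the block-circulant matrix whose $(i,j)$ block is $X_{((i-j)\bmod p)+1}$. The T-product of $\mathscr{X}\in\mathbb{C}^{n\times m\times p}$ and $\mathscr{Y}\in\mathbb{C}^{m\times\ell\times p}$ is $\mathscr{X}*\mathscr{Y}=\mathrm{Fold}(\mathrm{bcirc}(\mathscr{X})\,\mathrm{Unfold}(\mathscr{Y}))\in\mathbb{C}^{n\times\ell\times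 p}$. The conjugate transpose $\mathscr{X}^H\in\mathbb{C}^{m\times n\times p}$ is the tensor with $\mathrm{bcirc}(\mathscr{X}^H)=\mathrm{bcirc}(\mathscr{X})^H$. A tubular tensor of length $p$ is a $1\times1\times p$ tensor; for $v\in\mathbb{C}^p$, $[v]$ is the tubular tensor with $[v]_{11j}=v_j$, and $\mathrm{circ}([v])$ is the $p\times p$ circulant matrix with $(i,j)$ entry $v_{((i-j)\bmod p)+1}$. An $n\times n\times p$ tensor is non-singular if it has a two-sided inverse for $*$ with respect to the identity tensor (first frontal slice $I_n$, the others zero); equivalently its $\mathrm{bcirc}$ is a non-singular matrix. Eigentuple: for $X\in\mathbb{C}^{n\times p}$, $\mathscr{A}*_m X\in\mathbb{C}^{n\times p}$ denotes the matrix obtained by viewing $X$ as an $n\times1\times p$ tensor (its $k$-th column being the $k$-th frontal slice), forming the T-product with $\mathscr{A}$ on the left, and reshaping the resulting $n\times 1\times p$ tensor back into an $n\times p$ matrix in the same manner. A vector $d\in\mathbb{C}^p$ is an eigentuple of $\mathscr{A}$ with associated eigenmatrix $X\in\mathbb{C}^{n\times p}$, $X\neq0$, if $\mathscr{A}*_mX=X\,\mathrm{circ}([d])$. Here $\mathrm{vec}(X)$ stacks the columns of $X$. Tubular eigenvalue: a tubular tensor $[\lambda]$ of length $p$ is a tubular eigenvalue of $\mathscr{A}\in\mathbb{C}^{n\times n\times p}$ with (associated) eigentensor $\mathscr{X}\in\mathbb{C}^{n\times1\times p}$ if $\mathscr{A}*\mathscr{X}=\mathscr{X}*[\lambda]$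 and the tubular tensor $\mathscr{X}^H*\mathscr{X}$ is non-singular. *)

(* Defs.v *)
From HB Require Import structures.
From mathcomp Require Import all_boot all_order all_algebra.
From mathcomp Require Import reals complex.

Set Implicit Arguments.
Unset Strict Implicit.
Unset Printing Implicit Defensive.

Import Order.TTheory GRing.Theory Num.Theory.
Local Open Scope ring_scope.
Local Open Scope sesquilinear_scope.

(* X k is the k-th frontal slice.  Tube lengths are positive, so they appear
   as p.+1; slices are numbered from 0, and subtraction in 'I_p.+1 is
   subtraction modulo p.+1. *)
Notation tensor C n m p := {ffun 'I_p -> 'M[C]_(n, m)}.

Section Tensors.
Variable C : numClosedFieldType.

Definition unfold n m p (X : tensor C n m p) : 'M[C]_(\sum_(k < p) n, m) :=
  \mxcol_(k < p) X k.

Definition fold n m p (M : 'M[C]_(\sum_(k < p) n, m)) : tensor C n m p :=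
  [ffun k => submxcol M k].

Definition bcirc n m p (X : tensor C n m p.+1) :
    'M[C]_(\sum_(i < p.+1) n, \sum_(j < p.+1) m) :=
  \mxblock_(i < p.+1, j < p.+1) X (i - j).

Definition tmul n m l p (X : tensor C n m p.+1) (Y : tensor C m l p.+1) :
    tensor C n l p.+1 :=
  fold (bcirc X *m unfold Y).

(* The unique tensor whose bcirc is the conjugate transpose of bcirc X: see
   bcirc_tctr and bcirc_inj below. *)
Definition tctr n m p (X : tensor C n m p.+1) : tensor C m n p.+1 :=
  [ffun k => (X (- k)) ^t*].

Definition tid n p : tensor C n n p.+1 :=
  [ffun k => if k == ord0 then 1%:M else 0].

Definition tnonsingular n p (X : tensor C n n p.+1) : Prop :=
  exists Y : tensor C n n p.+1, tmul X Y = tid n p /\ tmul Y X = tid n p.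

Definition tubular p (v : 'cV[C]_p) : tensor C 1 1 p :=
  [ffun j => (v j 0)%:M].

Definition circ p (t : tensor C 1 1 p.+1) : 'M[C]_p.+1 :=
  \matrix_(i, j) t (i - j) 0 0.

Definition tensor_of_mx n p (X : 'M[C]_(n, p)) : tensor C n 1 p :=
  [ffun k => col k X].

Definition mx_of_tensor n p (T : tensor C n 1 p) : 'M[C]_(n, p) :=
  \matrix_(i, k) T k i 0.

Definition tmulm n p (A : tensor C n n p.+1) (X : 'M[C]_(n, p.+1)) :
    'M[C]_(n, p.+1) :=
  mx_of_tensor (tmul A (tensor_of_mx X)).

Definition eigentuple n p (A : tensor C n n p.+1) (d : 'cV[C]_p.+1)
    (X : 'M[C]_(n, p.+1)) : Prop :=
  X != 0 /\ tmulm A X = X *m circ (tubular d).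

Definition vec n p (X : 'M[C]_(n, p)) : 'cV[C]_(\sum_(k < p) n) :=
  \mxcol_(k < p) col k X.

Definition tubular_eigenvalue n p (A : tensor C n n p.+1)
    (lam : tensor C 1 1 p.+1) (X : tensor C n 1 p.+1) : Prop :=
  tmul A X = tmul X lam /\ tnonsingular (tmul (tctr X) X).

Lemma unfoldK n m p : cancel (@unfold n m p) (@fold n m p).
Proof. by move=> X; apply/ffunP=> k; rewrite ffunE mxcolK. Qed.

Lemma foldK n m p : cancel (@fold n m p) (@unfold n m p).
Proof. by move=> M; apply/mxcolP=> k; rewrite mxcolK ffunE. Qed.

Lemma bcirc_tctr n m p (X : tensor C n m p.+1) :
  bcirc (tctr X) = (bcirc X) ^t*.
Proof.
apply/matrixP=> i j; rewrite !mxE ffunE !mxE.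
by rewrite opprB.
Qed.

Lemma bcirc_inj n m p : injective (@bcirc n m p).
Proof.
move=> X Y eqXY; apply/ffunP=> k.
have /mxblockP/(_ k 0) := eqXY.
by rewrite !mxblockK subr0.
Qed.

End Tensors.

(* Main.v *)
Require Import Defs.
From mathcomp Require Import all_boot all_order all_algebra.
From mathcomp Require Import reals complex.

Import Order.TTheory GRing.Theory Num.Theory.
Local Open Scope ring_scope.
Local Open Scope complex_scope.

(** The T-product is a cyclic convolution of frontal slices: slice [k] of
    [X * Y] is the sum over [j] of [X (k - j) *m Y j], indices being taken
    modulo the tube length ([tmulE]).  The definition of [lam] says that
    [lam i] is [d (- i)] in cyclic indexing ([inord_opp]), so slice [k] of
    [XX * lam] is the sum over [l] of [d (l - k)] times column [l] of [X]:
    this is column [k] of [X *m circ (tubular d)] ([tmul_of_mx_opp]), which is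
    column [k] of [tmulm A X] since [d] is an eigentuple. *)

Lemma tmulE (C : numClosedFieldType) (n m l p : nat)
    (X : tensor C n m p.+1) (Y : tensor C m l p.+1) (k : 'I_p.+1) :
  tmul X Y k = \sum_j X (k - j) *m Y j.
Proof. by rewrite ffunE /bcirc /unfold mul_mxblock_mxrow mxcolK. Qed.

Lemma tensor_of_mxK (C : numClosedFieldType) (n p : nat) :
  cancel (@mx_of_tensor C n p) (@tensor_of_mx C n p).
Proof.
by move=> T; apply/ffunP=> k; apply/matrixP=> i j; rewrite ffunE !mxE (ord1 j).
Qed.

Lemma inord_opp (p : nat) (i : 'I_p.+1) :
  i != ord0 -> inord (p.+1 - i) = - i.
Proof.
rewrite -lt0n => i_gt0; apply: val_inj.
have lt_p : (p.+1 - i < p.+1)%N by rewrite ltn_subrL i_gt0.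
by rewrite /= inordK // modn_small.
Qed.

(** Multiplying by a tubular tensor on the right of a lateral slice is
    multiplying by a circulant matrix, after reversing the tube cyclically. *)
Lemma tmul_of_mx_opp (C : numClosedFieldType) (n p : nat)
    (X : 'M[C]_(n, p.+1)) (d : 'cV[C]_p.+1) (lam : tensor C 1 1 p.+1) :
  (forall i, lam i 0 0 = d (- i) 0) ->
  tmul (tensor_of_mx X) lam = tensor_of_mx (X *m circ (tubular d)).
Proof.
move=> lamE; apply/ffunP=> k; apply/matrixP=> i z.
rewrite (ord1 z) tmulE ffunE summxE !mxE.
(* reindex by [j |-> k - j], an involution *)
rewrite (reindex_inj (h := fun j => k - j)) /=; last first.
  by apply: inv_inj => j; rewrite subKr.
apply: eq_bigr => j _.
by rewrite mxE big_ord1 !ffunE subKr lamE opprB !mxE !ffunE mxE eqxx mulr1n.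
Qed.

Theorem proposition2p8 (R : realType) (n p : nat)
    (A : tensor R[i] n n p.+1) (d : 'cV[R[i]]_p.+1) (X : 'M[R[i]]_(n, p.+1))
    (lam : tensor R[i] 1 1 p.+1) (XX : tensor R[i] n 1 p.+1)
    (hd : eigentuple A d X)
    (hlam0 : lam ord0 0 0 = d ord0 0)
    (hlam : forall i : 'I_p.+1, i != ord0 ->
       lam i 0 0 = d (inord (p.+1 - i)%N) 0)
    (hXX : unfold XX = vec X)
    (hns : tnonsingular (tmul (tctr XX) XX)) :
  tubular_eigenvalue A lam XX.
Proof.
split=> //.
have XXE : XX = tensor_of_mx X.
  by apply/ffunP=> k; move/mxcolP/(_ k): hXX; rewrite !mxcolK ffunE.
have lamE i : lam i 0 0 = d (- i) 0.
  have [->|i_neq0] := eqVneq i ord0; last by rewrite hlam // inord_opp.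
  by rewrite hlam0 [ord0 in RHS](_ : _ = 0) ?oppr0 //; apply: val_inj.
case: hd => _ eigX.
by rewrite XXE (tmul_of_mx_opp _ _ _ _ _ _ lamE) -eigX tensor_of_mxK.
Qed.
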